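(* Let $A\in\mathbb{C}^{n\times n}$ be a Hermitian matrix with eigenvalues $\lambda_1\le\dots\le\lambda_n$, let $1\le \ell<n$, and let $[\alpha,\beta]$, $\alpha<\beta$, be an interval with $\lambda_1,\dots,\lambda_\ell<\alpha$ and $\lambda_{\ell+1},\dots,\lambda_n\in[\alpha,\beta]$. Let $V\in\mathbb{C}^{n\times\ell}$ be an array of orthonormal vectors, let $m\ge1$ be an integer, and let $V$ be filtered by the Chebyshev polynomial of degree $m$ defined by $p_m(A)$ (with the representation of $p_m(A)V$ and the numbers $|\rho_a|$ given in the context). For the given $m$, let the filtered subspace be built such that $$1<|\rho_\ell|^m<1+\sqrt2 .$$ Then the following inequality holds for a constant $\eta>1$: $$\kappa_2\big(p_m(A)V\big)\le \eta\,|\rho_1|^m .$$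
   Context: For a rectangular matrix $M$, $\kappa_2(M)=\|M\|_2\|M^+\|_2=\sigma_{\max}(M)/\sigma_{\min}(M)$, where $M^+$ is the pseudo-inverse and $\sigma_{\max},\sigma_{\min}$ are the largest and smallest non-zero singular values. Put $c=\frac{\alpha+\beta}{2}$, $e=\frac{\beta-\alpha}{2}$. For $\lambda_a\notin[\alpha,\beta]$ define $$|\rho_a|=\max_{\pm}\left|\frac{\lambda_a-c}{e}\pm\sqrt{\Big(\frac{\lambda_a-c}{e}\Big)^2-1}\right|>1 .$$ So $|\rho_1|\ge|\rho_2|\ge\dots\ge|\rho_\ell|>1$. The filter is $p_m(\lambda)=C_m\big(\frac{\lambda-c}{e}\big)/C_m\big(\frac{\lambda_1-c}{e}\big)$, where $C_m$ is the Chebyshev polynomial of the first kind of degree $m$. The same degree $m$ is applied to all columns of $V$, and no vectors are locked or deflated. Let $A=X\Lambda X^H$ be a spectral decomposition with $X=(X_\ell\ X_3)$ unitary, where $X_\ell\in\mathbb{C}^{n\times\ell}$ contains eigenvectors for $\lambda_1,\dots,\lambda_\ell$ and $X_3\in\mathbb{C}^{n\times(n-\ell)}$ contains those for $\lambda_{\ell+1},\dots,\lambda_n$. Put $S_\ell=X_\ell^HV\in\mathbb{C}^{\ell\times\ell}$ and $S_3=X_3^HV\in\mathbb{C}^{(n-\ell)\times\ell}$, so $V=X_\ell S_\ell+X_3S_3$. It is a standing assumption that $S_\ell$ is invertible. Standing convention: the filtered array is $$p_m(A)V = X_\ell\Gamma_\ell^mS_\ell+X_3\Gamma_3^mS_3,$$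 where the diagonal matrices $\Gamma_\ell^m=p_m(\mathrm{diag}(\lambda_1,\dots,\lambda_\ell))$ and $\Gamma_3^m=p_m(\mathrm{diag}(\lambda_{\ell+1},\dots,\lambda_n))$ are identified with their leading asymptotic expressions $$\Gamma_\ell^m=|\rho_1|^{-m}\,\mathrm{diag}(|\rho_1|^m,|\rho_2|^m,\dots,|\rho_\ell|^m),\qquad \Gamma_3^m=|\rho_1|^{-m}I_{n-\ell}.$$ The claim is about the matrix $p_m(A)V$ given by this expression. *)

(* Defs.v *)
From mathcomp Require Import all_boot all_order all_algebra.
From mathcomp Require Import complex classical_sets reals.

Set Implicit Arguments.
Unset Strict Implicit.
Unset Printing Implicit Defensive.

Import Order.TTheory GRing.Theory Num.Theory.

Local Open Scope classical_set_scope.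
Local Open Scope ring_scope.
Local Open Scope complex_scope.
Local Open Scope sesquilinear_scope.

Section ConditionNumber.
Variables (R : realType) (p q : nat).
Implicit Type M : 'M[R[i]]_(p, q).

Definition nonzero_singular_values M : set R :=
  [set s : R | 0 < s /\ eigenvalue (M^t* *m M) (s ^+ 2)%:C].

(* The set is finite, and nonempty when M != 0, so that sup and inf are then
   attained. *)
Definition sigma_max M : R := sup (nonzero_singular_values M).
Definition sigma_min M : R := inf (nonzero_singular_values M).

Definition kappa2 M : R := sigma_max M / sigma_min M.

End ConditionNumber.

Definition first_ord (l : nat) (l_gt0 : (0 < l)%N) : 'I_l := Ordinal l_gt0.
Definition last_ord (l : nat) (l_gt0 : (0 < l)%N) : 'I_l :=
  rev_ord (Ordinal l_gt0).

(* |rho| for the eigenvalue x. The radicand is positive when x is outside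
   [alpha, beta]; Num.sqrt is 0 on negative numbers. *)
Definition rho (R : realType) (alpha beta x : R) : R :=
  let c := (alpha + beta) / 2 in
  let e := (beta - alpha) / 2 in
  let t := (x - c) / e in
  Num.max `|t + Num.sqrt (t ^+ 2 - 1)| `|t - Num.sqrt (t ^+ 2 - 1)|.

(* The ambient dimension is n = l + k; the wanted eigenpairs are the first l
   ones, so that X = row_mx (lsubmx X) (rsubmx X) is the splitting (X_l X_3). *)
Section FilteredArray.
Variables (R : realType) (l k : nat).
Variables (alpha beta : R) (lam : 'I_(l + k) -> R).

Definition spectrum_mx : 'M[R[i]]_(l + k) := diag_mx (\row_a (lam a)%:C).

Definition rho_of (a : 'I_l) : R := rho alpha beta (lam (lshift k a)).

(* Leading asymptotic expressions of p_m(diag(lambda_1, ..., lambda_l)) and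
   p_m(diag(lambda_(l+1), ..., lambda_n)) for the filter
   p_m(x) = C_m((x - c) / e) / C_m((lambda_1 - c) / e), where C_m is the
   Chebyshev polynomial of the first kind; by convention they stand for
   these diagonal matrices. *)
Definition Gamma_l (l_gt0 : (0 < l)%N) (m : nat) : 'M[R[i]]_l :=
  (rho_of (first_ord l_gt0) ^- m)%:C *:
    diag_mx (\row_a (rho_of a ^+ m)%:C).

Definition Gamma_3 (l_gt0 : (0 < l)%N) (m : nat) : 'M[R[i]]_k :=
  (rho_of (first_ord l_gt0) ^- m)%:C *: 1%:M.

Definition S_l (X : 'M[R[i]]_(l + k)) (V : 'M[R[i]]_(l + k, l)) :
  'M[R[i]]_l := (lsubmx X)^t* *m V.

Definition S_3 (X : 'M[R[i]]_(l + k)) (V : 'M[R[i]]_(l + k, l)) :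
  'M[R[i]]_(k, l) := (rsubmx X)^t* *m V.

(* The array p_m(A) V, for A = X *m spectrum_mx *m X^t*. *)
Definition filtered_array (l_gt0 : (0 < l)%N) (m : nat)
    (X : 'M[R[i]]_(l + k)) (V : 'M[R[i]]_(l + k, l)) : 'M[R[i]]_(l + k, l) :=
  lsubmx X *m Gamma_l l_gt0 m *m S_l X V
  + rsubmx X *m Gamma_3 l_gt0 m *m S_3 X V.

End FilteredArray.

(* Main.v *)
Require Import Defs.
From mathcomp Require Import all_boot all_order all_algebra.
From mathcomp Require Import complex classical_sets reals.

Set Implicit Arguments.
Unset Strict Implicit.
Unset Printing Implicit Defensive.

Import Order.TTheory GRing.Theory Num.Theory.

Local Open Scope ring_scope.
Local Open Scope complex_scope.
Local Open Scope sesquilinear_scope.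

(** In exact terms the filtered array is a product [X D W], where [X] is
    unitary, [D] is a real diagonal matrix and [W = X^* V] has orthonormal
    columns: the columns of [V] are orthonormal and a unitary matrix preserves
    this.  The diagonal of [D] consists of the numbers
    [(|rho_a| / |rho_1|)^m] for the wanted eigenvalues and of [|rho_1|^-m] for
    the others.  To the left of [alpha], [|rho|] is nonincreasing in the
    eigenvalue and at least 1, so that all diagonal entries of [D] lie in
    [[|rho_1|^-m, 1]].

    An isometry followed by a diagonal scaling and another isometry stretches
    every vector by a factor between the smallest and the largest scaling
    factor ([singular_value_bounds]).  Hence all singular values of the
    filtered array lie in [[|rho_1|^-m, 1]], and the quotient of the largest
    by the smallest is at most [|rho_1|^m].  The bound therefore holds for
    every constant [eta >= 1]; the proof takes [eta = 2]. *)

(** * Condition numbers from bounds on singular values *)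

(** The case distinction on emptiness is genuine: [sup] and [inf] of the empty
    set are both 0, so that the zero matrix has [kappa2] equal to [0 / 0 = 0].
    *)
Lemma kappa2_le (R : realType) (p q : nat) (M : 'M[R[i]]_(p, q)) (a b : R) :
  0 < a -> 0 <= b ->
  (forall s, nonzero_singular_values M s -> a <= s <= b) ->
  kappa2 M <= b / a.
Proof.
move=> a_gt0 b_ge0 sv_ab; rewrite /kappa2 /sigma_max /sigma_min.
have [->|/set0P ne] := eqVneq (nonzero_singular_values M) set0%classic.
  by rewrite sup0 mul0r divr_ge0 // ltW.
have le_inf : a <= inf (nonzero_singular_values M).
  by apply: lb_le_inf => // s /sv_ab /andP[].
have sup_le : sup (nonzero_singular_values M) <= b.
  by apply: ge_sup => // s /sv_ab /andP[].
have inf_gt0 := lt_le_trans a_gt0 le_inf.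
rewrite ler_pdivrMr // (le_trans sup_le) // mulrAC ler_pdivlMr //.
by rewrite ler_wpM2l.
Qed.

Lemma trmxC_mul (C : numClosedFieldType) (m n p : nat)
    (A : 'M[C]_(m, n)) (B : 'M[C]_(n, p)) :
  (A *m B)^t* = B^t* *m A^t*.
Proof. by rewrite trmx_mul map_mxM. Qed.

(** The diagonal case of a Hermitian form; with [d = 1] it is the squared
    norm of [u]. *)
Lemma diag_form (C : numClosedFieldType) (n : nat) (d u : 'rV[C]_n) :
  (u *m diag_mx d *m u^t*) 0 0 = \sum_j d 0 j * `|u 0 j| ^+ 2.
Proof.
rewrite mxE; apply: eq_bigr => j _.
by rewrite mul_mx_diag !mxE normCK mulrA [d 0 j * _]mulrC.
Qed.

Lemma real_diag_trmxC (R : realType) (n : nat) (d : 'I_n -> R) :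
  (diag_mx (\row_j (d j)%:C))^t* = diag_mx (\row_j (d j)%:C) :> 'M[R[i]]_n.
Proof.
rewrite tr_diag_mx; apply/matrixP => i j; rewrite !mxE rmorphMn /=.
by congr (_ *+ _); exact: conjc_real.
Qed.

(** If [v] is an eigenvector of [M^* M] for [s^2], then [u = v W^*] satisfies
    [u D^2 u^* = s^2 u u^*], because [U^* U = 1] and [W^* W = 1].  So [s^2] is
    a weighted mean of the squares [(d j)^2], with weights [|u_j|^2]. *)
Lemma singular_value_bounds (R : realType) (p n q : nat)
    (U : 'M[R[i]]_(p, n)) (W : 'M[R[i]]_(n, q)) (d : 'I_n -> R) (a b : R) :
  U^t* *m U = 1%:M -> W^t* *m W = 1%:M ->
  0 <= a -> (forall j, a <= d j <= b) ->
  forall s, nonzero_singular_values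
    (U *m diag_mx (\row_j (d j)%:C) *m W) s -> a <= s <= b.
Proof.
move=> U_iso W_iso a_ge0 d_ab s [s_gt0 /eigenvalueP[v]].
set D := diag_mx _ => v_eig v_neq0.
pose u := v *m W^t*.
have u_neq0 : u != 0.
  apply: contraNneq v_neq0 => u0.
  by rewrite -[v]mulmx1 -W_iso mulmxA -/u u0 mul0mx.
have gramE : (U *m D *m W)^t* *m (U *m D *m W) = W^t* *m (D *m D) *m W.
  rewrite !trmxC_mul real_diag_trmxC -/D !mulmxA.
  by rewrite -[_ *m U^t* *m U]mulmxA U_iso mulmx1.
have form_eq : u *m (D *m D) *m u^t* = (s ^+ 2)%:C *: (u *m 1%:M *m u^t*).
  rewrite mulmx1 {2 4}/u trmxC_mul trmxCK !mulmxA scalemxAl.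
  move: v_eig; rewrite gramE !mulmxA -/u => ->.
  by rewrite -[u *m W]mulmxA W_iso mulmx1.
pose N : R[i] := \sum_j `|u 0 j| ^+ 2.
have N_gt0 : 0 < N.
  have [j uj] : exists j, u 0 j != 0 by apply/rV0Pn.
  rewrite /N (bigD1 j) //= ltr_pwDl ?exprn_gt0 ?normr_gt0 //.
  by apply: sumr_ge0 => k _; rewrite exprn_ge0.
have mean : \sum_j (d j ^+ 2)%:C * `|u 0 j| ^+ 2 = (s ^+ 2)%:C * N.
  have /matrixP/(_ 0 0) := form_eq.
  rewrite -diag_const_mx mulmx_diag diag_form [RHS]mxE diag_form => mean_eq.
  rewrite (_ : N = \sum_j (const_mx 1 : 'rV_n) 0 j * `|u 0 j| ^+ 2).
    by rewrite -mean_eq; apply: eq_bigr => j _; rewrite !mxE -rmorphM.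
  by apply: eq_bigr => j _; rewrite [const_mx _ _ _]mxE mul1r.
have b_ge0 : 0 <= b.
  have [j _] : exists j, u 0 j != 0 by apply/rV0Pn.
  by have /andP[/(le_trans a_ge0) dj_ge0 /(le_trans dj_ge0)] := d_ab j.
suff /andP[lo hi] : a ^+ 2 <= s ^+ 2 <= b ^+ 2.
  by rewrite -(ler_pXn2r (ltn0Sn 1) a_ge0 (ltW s_gt0)) lo
             -(ler_pXn2r (ltn0Sn 1) (ltW s_gt0) b_ge0).
suff : (a ^+ 2)%:C * N <= (s ^+ 2)%:C * N <= (b ^+ 2)%:C * N.
  by rewrite !(ler_pM2r N_gt0) !lecR.
rewrite -mean /N !mulr_sumr; apply/andP; split; apply: ler_sum => j _;
  have /andP[ad db] := d_ab j; have d_ge0 := le_trans a_ge0 ad;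
  by rewrite ler_wpM2r ?exprn_ge0 // lecR ler_pXn2r.
Qed.

(** * The growth factor to the left of the damped interval *)

(** The square root is nonnegative, so that the larger absolute value belongs
    to the sign for which the two terms do not cancel.  In this form [rho] is
    visibly nondecreasing in [`|t|]. *)
Lemma rhoE (R : realType) (alpha beta x : R) :
  let t := (x - (alpha + beta) / 2) / ((beta - alpha) / 2) in
  rho alpha beta x = `|t| + Num.sqrt (t ^+ 2 - 1).
Proof.
move=> t; rewrite /rho -/t; set r := Num.sqrt _.
have r_ge0 : 0 <= r by exact: sqrtr_ge0.
apply/eqP; rewrite eq_le ge_max; apply/andP; split.
  rewrite -{2 4}(ger0_norm r_ge0) ler_normD /=.
  by rewrite (le_trans (ler_normB _ _)).
rewrite le_max; case: (lerP 0 t) => t0.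
  by rewrite (ger0_norm t0) (ger0_norm (addr_ge0 t0 r_ge0)) lexx.
by rewrite (ltr0_norm t0) [X in _ || X]ler_normr opprB [r - t]addrC lexx !orbT.
Qed.

Lemma affine_lt_m1 (R : realType) (alpha beta x : R) :
  alpha < beta -> x < alpha ->
  (x - (alpha + beta) / 2) / ((beta - alpha) / 2) < -1.
Proof.
move=> ab xa; rewrite ltr_pdivrMr ?divr_gt0 ?subr_gt0 // mulN1r.
rewrite ltrBlDr -mulNr opprB -mulrDl.
by rewrite addrACA addNr addr0 -mulr2n -(mulr_natr alpha) mulfK ?pnatr_eq0.
Qed.

Lemma rho_ge1 (R : realType) (alpha beta x : R) :
  alpha < beta -> x < alpha -> 1 <= rho alpha beta x.
Proof.
move=> ab xa; have t_lt := affine_lt_m1 ab xa.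
by rewrite rhoE ler_wpDr ?sqrtr_ge0 // ler_normr lerNr (ltW t_lt) orbT.
Qed.

Lemma rho_le (R : realType) (alpha beta x y : R) :
  alpha < beta -> x <= y -> y < alpha ->
  rho alpha beta y <= rho alpha beta x.
Proof.
move=> ab xy ya; have := affine_lt_m1 ab ya.
rewrite !rhoE; set tx := (x - _) / _; set ty := (y - _) / _ => ty_lt.
have txy : tx <= ty.
  by rewrite ler_pM2r ?invr_gt0 ?divr_gt0 ?subr_gt0 // lerD2r.
have ty_lt0 : ty < 0 by rewrite (lt_trans ty_lt) // ltrN10.
have norm_le : `|ty| <= `|tx|.
  by rewrite !ltr0_norm ?lerN2 // (le_lt_trans txy).
rewrite lerD // ler_wsqrtr // lerD2r -[ty ^+ 2]real_normK ?num_real //.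
by rewrite -[tx ^+ 2]real_normK ?num_real // lerXn2r ?nnegrE.
Qed.

(** * The filtered array as a product of isometries and a scaling *)

Section Factorisation.
Variables (R : realType) (l k : nat) (alpha beta : R) (lam : 'I_(l + k) -> R).
Variables (l_gt0 : (0 < l)%N) (m : nat).

Definition filter_gain (j : 'I_(l + k)) : R :=
  rho_of alpha beta lam (first_ord l_gt0) ^- m *
  match split j with
  | inl a => rho_of alpha beta lam a ^+ m
  | inr _ => 1
  end.

Lemma filtered_arrayE (X : 'M[R[i]]_(l + k)) (V : 'M[R[i]]_(l + k, l)) :
  filtered_array alpha beta lam l_gt0 m X V =
  X *m diag_mx (\row_j (filter_gain j)%:C) *m (X^t* *m V).
Proof.
have gainE : diag_mx (\row_j (filter_gain j)%:C) =
    block_mx (Gamma_l alpha beta lam l_gt0 m) 0 0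
             (Gamma_3 alpha beta lam l_gt0 m).
  rewrite /Gamma_l /Gamma_3 -diag_const_mx -!linearZ /= -diag_mx_row.
  congr diag_mx; apply/rowP => j; rewrite !mxE /filter_gain.
  by case: split => a; rewrite !mxE rmorphM ?rmorph1.
have XT : X^t* = col_mx ((lsubmx X)^t*) ((rsubmx X)^t*).
  by rewrite -{1}[X]hsubmxK tr_row_mx map_col_mx.
rewrite gainE XT -[Z in Z *m block_mx _ _ _ _]hsubmxK.
rewrite mul_row_block mul_col_mx !mulmx0 addr0 add0r.
by rewrite mul_row_col.
Qed.

Hypothesis alpha_lt_beta : alpha < beta.
Hypothesis lam_sorted : forall i j : 'I_(l + k), (i <= j)%N -> lam i <= lam j.
Hypothesis lam_lt_alpha : forall a : 'I_l, lam (lshift k a) < alpha.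

Lemma rho_of_ge1 (a : 'I_l) : 1 <= rho_of alpha beta lam a.
Proof. exact: rho_ge1. Qed.

Lemma rho_of_le_first (a : 'I_l) :
  rho_of alpha beta lam a <= rho_of alpha beta lam (first_ord l_gt0).
Proof. by apply: rho_le => //; exact: lam_sorted. Qed.

Lemma filter_gain_bounds (j : 'I_(l + k)) :
  rho_of alpha beta lam (first_ord l_gt0) ^- m <= filter_gain j <= 1.
Proof.
have r1 := rho_of_ge1 (first_ord l_gt0).
have rm_gt0 : 0 < rho_of alpha beta lam (first_ord l_gt0) ^+ m.
  by rewrite exprn_gt0 // (lt_le_trans ltr01).
rewrite /filter_gain mulrC ler_pdivrMr // mul1r.
rewrite ler_peMl ?invr_ge0 ?(ltW rm_gt0) //=; case: split => [a|b].
- by rewrite lerXn2r ?rho_of_le_first // nnegrE (le_trans ler01) ?rho_of_ge1.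
- exact: exprn_ege1.
- exact: exprn_ege1 (rho_of_ge1 a).
- exact: lexx.
Qed.

End Factorisation.

Theorem proposition3p2 (R : realType) :
  exists eta : R, 1 < eta /\
  forall (l k m : nat) (l_gt0 : (0 < l)%N) (k_gt0 : (0 < k)%N)
    (m_gt0 : (0 < m)%N)
    (A X : 'M[R[i]]_(l + k)) (lam : 'I_(l + k) -> R) (alpha beta : R)
    (V : 'M[R[i]]_(l + k, l)),
  A \is hermsymmx ->
  X \is unitarymx ->
  A = X *m spectrum_mx lam *m X^t* ->
  (forall i j : 'I_(l + k), (i <= j)%N -> lam i <= lam j) ->
  alpha < beta ->
  (forall a : 'I_l, lam (lshift k a) < alpha) ->
  (forall b : 'I_k, alpha <= lam (rshift l b) <= beta) ->
  V^t* *m V = 1%:M ->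
  S_l X V \in unitmx ->
  1 < rho_of alpha beta lam (last_ord l_gt0) ^+ m < 1 + Num.sqrt 2 ->
  kappa2 (filtered_array alpha beta lam l_gt0 m X V)
    <= eta * rho_of alpha beta lam (first_ord l_gt0) ^+ m.
Proof.
exists 2; split; first by rewrite ltr1n.
move=> l k m l_gt0 _ _ _ X lam alpha beta V _ X_unitary _ lam_sorted
  alpha_lt_beta lam_lt_alpha _ V_iso _ _.
set r := rho_of _ _ _ (first_ord l_gt0).
have r_gt0 : 0 < r.
  by rewrite (lt_le_trans ltr01) // rho_of_ge1.
have XT_unitary := X_unitary; rewrite -trmxC_unitary in XT_unitary.
have X_iso : X^t* *m X = 1%:M.
  by have /unitarymxP := XT_unitary; rewrite trmxCK.
have W_iso : (X^t* *m V)^t* *m (X^t* *m V) = 1%:M.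
  rewrite trmxC_mul trmxCK mulmxA -[_ *m X *m _]mulmxA.
  by rewrite (unitarymxP X_unitary) mulmx1.
apply: (@le_trans _ _ (1 / r ^- m)).
  rewrite filtered_arrayE; apply: kappa2_le; rewrite ?invr_gt0 ?exprn_gt0 //.
  apply: singular_value_bounds => // [|j].
    by rewrite invr_ge0 exprn_ge0 // ltW.
  exact: filter_gain_bounds.
by rewrite div1r invrK ler_peMl ?exprn_ge0 ?(ltW r_gt0) // ler1n.
Qed.
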